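(* For every $n\ge1$, the number of $1$-almost-increasing permutations in $S_n$ equals the number of evil-avoiding permutations in $S_n$.
   Context: A permutation $\pi\in S_n$ (one-line form) is $1$-almost-increasing if for every $i\in\{1,\dots,n\}$ there is at most one $j\le i$ with $\pi_j>i$; equivalently, $\pi$ avoids $4321,4312,3421,3412$. A permutation is evil-avoiding if it avoids $2413,4132,4213,3214$. *)

(* Defs.v *)
From mathcomp Require Import all_boot all_fingroup.
Set Implicit Arguments. Unset Strict Implicit. Unset Printing Implicit Defensive.

(* Permutations of S_n are elements of {perm 'I_n}; positions and values are
   0-indexed (i stands for i+1 in the paper). One-line form: pi_i = s i. *)

Definition contains_pattern (n : nat) (s : {perm 'I_n}) (p : seq nat) : bool :=
  [exists f : {ffun 'I_(size p) -> 'I_n},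
    [forall a : 'I_(size p), forall b : 'I_(size p),
       ((a < b) ==> (f a < f b)) &&
       ((s (f a) < s (f b)) == (nth 0 p a < nth 0 p b))]].

Definition avoids (n : nat) (s : {perm 'I_n}) (p : seq nat) : bool :=
  ~~ contains_pattern s p.

(* 1-almost-increasing: for every position i, at most one j <= i with pi_j > i
   (0-indexed translation of the 1-indexed condition, shifting both by 1). *)
Definition almost_increasing1 (n : nat) (s : {perm 'I_n}) : bool :=
  [forall i : 'I_n, #|[set j : 'I_n | (j <= i) && (i < s j)]| <= 1].

Definition evil_avoiding (n : nat) (s : {perm 'I_n}) : bool :=
  [&& avoids s [:: 2; 4; 1; 3], avoids s [:: 4; 1; 3; 2],
      avoids s [:: 4; 2; 1; 3] & avoids s [:: 3; 2; 1; 4]].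

(* Main.v *)
(* Both classes are counted by the recursion (x, o) |-> (x + o, x + 3 o) from
   (1, 0), so that both counts satisfy a(n+2) = 4 a(n+1) - 2 a(n).

   1-almost-increasing: x counts the words of size n and o the words of size
   n + 1 whose last entry is not the maximum n. An open word of size n + 2
   arises in exactly one way by inserting n + 1 before the last entry of an
   open word, by replacing its n by n + 1 and placing n in the last or in the
   last but one position, or by appending n + 1, n to a word of size n.

   Evil-avoiding: write w = u 0 v. If u is empty, v is arbitrary. Otherwise no
   value of v lies between two values of u, and the values of v below u
   increase. If all of v lies below u, then w = u 0 1 ... (k-1) with u arbitrary
   (e such words). If some value of v lies above u, then u is a run of
   consecutive increasing values (h such words). A run of length at least 2 is
   shortened by one; for u = x the 0 is removed, which leaves either a word of
   the same kind or, when all large values precede all small ones in v, data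
   equivalent to a word u' 0 1 ... (x-1). This gives a' = a + e' + h', e'' = a' + e'
   and h' = 2 h + e, whence o = e' + h', primes denoting the shift n |-> n + 1. *)

Require Import Defs.
From mathcomp Require Import all_boot all_fingroup zify.
Set Implicit Arguments. Unset Strict Implicit. Unset Printing Implicit Defensive.

(** * Counting by duplicate-free lists *)

(** The classes to be counted live in infinite types, such as words or pairs of a number and a word,
    so a count is witnessed by an explicit enumeration. *)
Definition counted (T : eqType) (N : nat) (P : T -> Prop) : Prop :=
  exists L : seq T, [/\ uniq L, size L = N & forall x, x \in L <-> P x].

Lemma counted_ext (T : eqType) N (P Q : T -> Prop) :
  counted N P -> (forall x, Q x <-> P x) -> counted N Q.
Proof.
by case=> L [uL sL LP] QP; exists L; split=> // x; rewrite QP; apply: LP.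
Qed.

Lemma counted0 (T : eqType) (P : T -> Prop) : (forall x, ~ P x) -> counted 0 P.
Proof. by move=> nP; exists [::]; split=> // x; split=> // /nP. Qed.

Lemma counted_image (T U : eqType) (f : T -> U) N (P : T -> Prop) :
  counted N P -> (forall x y, P x -> P y -> f x = f y -> x = y) ->
  counted N (fun z => exists2 x, P x & z = f x).
Proof.
case=> L [uL sL LP] fI; exists (map f L); split; rewrite ?size_map //.
  by rewrite map_inj_in_uniq // => x y /LP Px /LP; apply: fI.
move=> z; split; first by case/mapP=> x /LP Px ->; exists x.
by case=> x /LP Lx ->; apply: map_f.
Qed.

Lemma counted_or (T : eqType) M N (P Q : T -> Prop) :
  counted M P -> counted N Q -> (forall x, P x -> Q x -> False) ->
  counted (M + N) (fun x => P x \/ Q x).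
Proof.
case=> L [uL <- LP] [K [uK <- KQ]] PQ; exists (L ++ K).
split; rewrite ?size_cat //.
  rewrite cat_uniq uL uK andbT; apply/hasPn=> x /KQ Qx.
  by apply/negP=> /LP Px; apply: PQ Qx.
move=> x; rewrite mem_cat; split.
  by case/orP=> [/LP|/KQ]; [left | right].
by case=> [/LP|/KQ] ->; rewrite ?orbT.
Qed.

(** * Permutations as words of natural numbers *)

Definition isperm (n : nat) (w : seq nat) : bool :=
  [&& size w == n, uniq w & all (fun x => x < n) w].

Lemma isperm_perm n w1 w2 : perm_eq w1 w2 -> isperm n w1 = isperm n w2.
Proof.
by move=> E; rewrite /isperm (perm_size E) (perm_uniq E) (perm_all _ E).
Qed.

Lemma isperm_mem n w x : isperm n w -> (x \in w) = (x < n).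
Proof.
case/and3P=> /eqP sw uw /allP aw.
have [||_ E] := @uniq_min_size _ w (iota 0 n) uw.
- by move=> y /aw; rewrite mem_iota.
- by rewrite size_iota sw.
by rewrite E mem_iota.
Qed.

Lemma bump_lt h : {mono bump h : x y / x < y}.
Proof. by move=> x y; rewrite /bump; lia. Qed.

Lemma bump_inj h : injective (bump h).
Proof. exact: can_inj (bumpK h). Qed.

(** [bump x] raises the values from [x] on by one, which frees exactly the value [x]; this is the
    inverse of standardization. *)
Lemma isperm_bump n x t : x <= n ->
  isperm n.+1 (x :: map (bump x) t) = isperm n t.
Proof.
move=> xn; rewrite /isperm /= size_map eqSS (map_inj_uniq (@bump_inj x)).
rewrite ltnS xn all_map; have -> : x \notin map (bump x) t.
  by apply/mapP=> -[y _ /eqP]; rewrite (negPf (neq_bump x y)).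
congr [&& _, _ & _]; apply: eq_all => y /=; rewrite /bump; lia.
Qed.

Lemma isperm_cons n x w : isperm n.+1 (x :: w) ->
  exists2 t, isperm n t & w = map (bump x) t.
Proof.
move=> pw; exists (map (unbump x) w).
  have xn : x <= n by case/and3P: pw => _ _ /andP[].
  rewrite -(isperm_bump _ xn) -map_comp map_id_in //= => y yw /=.
  rewrite unbumpK //=; apply: contraTN pw => /eqP e.
  by rewrite /isperm /= -e yw andbF.
rewrite -map_comp map_id_in //= => y yw /=; rewrite unbumpK //=.
by apply: contraTN pw => /eqP e; rewrite /isperm /= -e yw andbF.
Qed.

Lemma isperm_rcons n w : isperm n.+1 (rcons w n) = isperm n w.
Proof.
rewrite /isperm size_rcons eqSS rcons_uniq all_rcons ltnSn /=.
apply/and3P/and3P=> -[sw]; last first.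
  move=> uw aw; split=> //; last by apply: sub_all aw => x; lia.
  by rewrite uw andbT; apply/negP=> /(allP aw); rewrite ltnn.
case/andP=> nw uw aw; split=> //; apply/allP=> x xw.
have := allP aw x xw; rewrite ltnS leq_eqVlt => /orP[/eqP e|//].
by rewrite -e xw in nw.
Qed.

Definition word (n : nat) (s : {perm 'I_n}) : seq nat :=
  [seq val (s i) | i <- enum 'I_n].

Lemma size_word n (s : {perm 'I_n}) : size (word s) = n.
Proof. by rewrite size_map size_enum_ord. Qed.

Lemma nth_word n (s : {perm 'I_n}) (i : 'I_n) : nth 0 (word s) i = s i.
Proof. by rewrite (nth_map i) ?size_enum_ord // nth_ord_enum. Qed.

Lemma word_isperm n (s : {perm 'I_n}) : isperm n (word s).
Proof.
have sI : injective (fun i => val (s i)) by move=> i j /val_inj/perm_inj.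
rewrite /isperm size_word eqxx (map_inj_uniq sI) enum_uniq /=.
by apply/allP=> x /mapP[i _ ->]; apply: ltn_ord.
Qed.

Lemma word_inj n : injective (@word n).
Proof.
move=> s t est; apply/permP=> i; apply: val_inj.
by rewrite /= -!nth_word est.
Qed.

Lemma word_surj n w : isperm n w -> exists s : {perm 'I_n}, word s = w.
Proof.
move=> pw; have /and3P[/eqP sw uw aw] := pw.
have ltw (i : 'I_n) : nth 0 w i < n.
  by apply: (allP aw); apply: mem_nth; rewrite sw.
have fI : injective (fun i : 'I_n => Ordinal (ltw i)).
  move=> i j /(congr1 val) /= /eqP; rewrite nth_uniq ?sw //.
  by move/eqP/val_inj.
exists (perm fI); apply: (@eq_from_nth _ 0); rewrite ?size_word // => i ilt.
by rewrite (nth_word _ (Ordinal ilt)) permE.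
Qed.

(** [word] is a bijection onto the words satisfying [isperm n], so counts of words transfer to
    permutations. *)
Lemma card_counted n N (p : pred {perm 'I_n}) (P : seq nat -> Prop) :
  counted N P -> (forall w, P w -> isperm n w) ->
  (forall s, p s <-> P (word s)) -> #|[set s | p s]| = N.
Proof.
case=> L [uL <- LP] Pw pP; rewrite cardE -(size_map (@word n)).
apply/perm_size/uniq_perm=> //.
  by rewrite (map_inj_uniq (@word_inj n)) enum_uniq.
move=> w; apply/mapP/idP.
  by case=> s; rewrite mem_enum inE => /pP ps ->; apply/LP.
move=> /LP Pww; have [s es] := word_surj (Pw _ Pww).
by exists s; rewrite // mem_enum inE; apply/pP; rewrite es.
Qed.

(** * 1-almost-increasing words *)

Fixpoint almost_counts (n : nat) : nat * nat :=
  if n is m.+1 then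
    let: (x, o) := almost_counts m in (x + o, x + 3 * o)
  else (1, 0).

Definition excess (i : nat) (w : seq nat) : nat := count (fun x => i < x) (take i.+1 w).

(** The index may run over all naturals, since from [n.-1] on no entry exceeds it. *)
Definition almost (n : nat) (w : seq nat) : Prop :=
  isperm n w /\ forall i, excess i w <= 1.

(* The pair (t, z) stands for the word rcons t z. *)
Definition almost_open (n : nat) (p : seq nat * nat) : Prop :=
  almost n.+1 (rcons p.1 p.2) /\ p.2 <> n.

Lemma almostE n (s : {perm 'I_n}) : almost_increasing1 s <-> almost n (word s).
Proof.
have cnt (i : nat) : i < n ->
    excess i (word s) = #|[set j : 'I_n | (j <= i) && (i < s j)]|.
  move=> ilt; rewrite /excess /word -map_take count_map -size_filter cardE.
  apply/perm_size/uniq_perm => [||j].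
  - by apply/filter_uniq/take_uniq/enum_uniq.
  - exact: enum_uniq.
  rewrite mem_filter mem_enum !inE andbC; congr (_ && _).
  have -> : take i.+1 (enum 'I_n) = [seq k : 'I_n <- enum 'I_n | k <= i].
    apply: (inj_map val_inj); rewrite map_take val_enum_ord.
    transitivity [seq k <- iota 0 n | k <= i].
      rewrite -(subnKC ilt) iotaD take_size_cat ?size_iota // filter_cat.
      rewrite (all_filterP _); last by apply/allP=> x; rewrite mem_iota ?add0n; lia.
      rewrite (eq_in_filter (a2 := pred0)) ?filter_pred0 ?cats0 // => x.
      rewrite mem_iota /=; lia.
    by rewrite -val_enum_ord filter_map.
  by rewrite mem_filter mem_enum andbT.
split.
  move/forallP=> A; split=> [|i]; first exact: word_isperm.
  have [ilt|ige] := ltnP i n; first by rewrite cnt //; apply: (A (Ordinal ilt)).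
  rewrite /excess (eq_in_count (a2 := pred0)) ?count_pred0 // => x /mem_take.
  rewrite (isperm_mem _ (word_isperm s)) /=; lia.
by case=> _ A; apply/forallP=> i; rewrite -cnt.
Qed.

Lemma excess_rcons i w x : i < size w -> excess i (rcons w x) = excess i w.
Proof.
by move=> ilt; rewrite /excess -cats1 takel_cat //.
Qed.

Lemma excess_all i w n : all (fun x => x < n) w -> n.-1 <= i -> excess i w = 0.
Proof.
move=> /allP aw ni; rewrite /excess (eq_in_count (a2 := pred0)) ?count_pred0 //.
by move=> x /mem_take/aw /=; lia.
Qed.

Lemma almost_rcons n w : almost n.+1 (rcons w n) <-> almost n w.
Proof.
rewrite /almost isperm_rcons; split=> -[pw A]; split=> // i;
  have /and3P[/eqP sw _ aw] := pw.
  have [ilt|ige] := ltnP i n; first by rewrite -(excess_rcons n) ?sw.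
  by rewrite (excess_all aw) //; lia.
have [ilt|ige] := ltnP i n; first by rewrite excess_rcons ?sw.
rewrite (@excess_all _ _ n.+1) //.
by rewrite all_rcons ltnSn /=; apply: sub_all aw => x; lia.
Qed.

(** [bump n] moves only values from [n] on, and these exceed [i] both before and after. *)
Lemma excess_bump n i w : i < n -> excess i (map (bump n) w) = excess i w.
Proof.
move=> ilt; rewrite /excess -map_take count_map; apply: eq_count => x /=.
by rewrite /bump; lia.
Qed.

(** No value exceeds [n], so the condition at the last position is void and the others see only
    [a]. *)
Lemma almost_rcons1 n a x : size a = n ->
  almost n.+1 (rcons a x) <->
  isperm n.+1 (rcons a x) /\ forall i, i < n -> excess i a <= 1.
Proof.
move=> sa; split=> -[pw A]; split=> // i.
  by move=> ilt; rewrite -(excess_rcons x) ?sa.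
have [ilt|ige] := ltnP i n; first by rewrite excess_rcons ?sa ?A.
by case/and3P: pw => _ _ aw; rewrite (excess_all aw).
Qed.

(* In a permutation of size n + 2 the only value exceeding n is n + 1, so the
   condition at position n is void. *)
Lemma almost_rcons2 n a x y : size a = n ->
  almost n.+2 (rcons (rcons a x) y) <->
  isperm n.+2 (rcons (rcons a x) y) /\ forall i, i < n -> excess i a <= 1.
Proof.
move=> sa; rewrite almost_rcons1 ?size_rcons ?sa //.
split=> -[pw A]; split=> // i ilt.
  by rewrite -(excess_rcons x) ?sa // A // ltnW.
have [iltn|ige] := ltnP i n; first by rewrite excess_rcons ?sa ?A.
have {ige ilt} -> : i = n by lia.
case/and3P: pw => _; rewrite rcons_uniq all_rcons => /andP[_ uw] /andP[_ aw].
rewrite /excess take_oversize ?size_rcons ?sa //.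
rewrite (@eq_in_count _ _ (pred1 n.+1)) ?count_uniq_mem ?leq_b1 // => z.
by move=> /(allP aw) /=; lia.
Qed.

Lemma perm_rcons2 (T : eqType) (a : seq T) x y :
  perm_eq (rcons (rcons a x) y) (rcons (rcons a y) x).
Proof.
by apply/seq.permP=> P; rewrite -!cats1 !count_cat /= !addn0 -!addnA (addnC (P x)).
Qed.

Lemma isperm_top n a z :
  isperm n.+2 (rcons (rcons a n.+1) z) = isperm n.+1 (rcons a z).
Proof. by rewrite (isperm_perm _ (perm_rcons2 _ _ _)) isperm_rcons. Qed.

Lemma bump_below h x : x < h -> bump h x = x.
Proof. by rewrite /bump; lia. Qed.

(** As [z < n] is fixed by [bump n], the left word rearranges [n :: map (bump n) (rcons t z)]. *)
Lemma isperm_next n t z : z < n ->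
  isperm n.+2 (rcons (rcons (map (bump n) t) n) z) = isperm n.+1 (rcons t z).
Proof.
move=> zn; rewrite -[RHS](isperm_bump _ (leqnSn n)) map_rcons (bump_below zn).
by rewrite (isperm_perm _ (perm_rcons2 _ _ _)) (isperm_perm _ (permEl (perm_rcons _ _))).
Qed.

Lemma isperm_nextE n a z : z < n -> isperm n.+2 (rcons (rcons a n) z) ->
  exists t, a = map (bump n) t.
Proof.
move=> zn; rewrite (isperm_perm _ (perm_rcons2 _ _ _)).
rewrite (isperm_perm _ (permEl (perm_rcons _ _))).
case/isperm_cons=> t0 _; case/lastP: t0 => [|t z'].
  by move/(congr1 size); rewrite size_rcons.
by rewrite map_rcons => /rcons_inj[-> _]; exists t.
Qed.

Lemma excess_bumps n t :
  (forall i, i < n -> excess i (map (bump n) t) <= 1) <->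
  (forall i, i < n -> excess i t <= 1).
Proof. by split=> A i ilt; move: (A i ilt); rewrite excess_bump. Qed.

Lemma almost_open_pair n q : almost_open n q ->
  [/\ size q.1 = n, q.2 < n & n \in q.1].
Proof.
case: q => t z [[/= pw _] zn]; have := isperm_mem z pw.
rewrite mem_rcons inE eqxx /= => /esym zlt.
have := isperm_mem n pw; rewrite mem_rcons inE ltnSn => /orP[/eqP e|nt].
  by case: zn.
split=> //; last by lia.
by case/and3P: pw; rewrite size_rcons eqSS => /eqP.
Qed.

(** Case analysis on the last two entries y, z. By [almost_rcons2] they are constrained only through
    the set of values they leave to the prefix, so they can be exchanged or altered freely. *)
Lemma almost_openS n p : almost_open n.+1 p <->
  ((exists2 t, almost n t & p = (rcons t n.+1, n)) \/
   (exists2 q, almost_open n q & p = (rcons q.1 n.+1, q.2))) \/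
  ((exists2 q, almost_open n q & p = (rcons (map (bump n) q.1) n, q.2)) \/
   (exists2 q, almost_open n q & p = (rcons (map (bump n) q.1) q.2, n))).
Proof.
split.
  case: p => s z [/= Aw zn].
  case/lastP: s Aw => [[]|a y] Aw; first by rewrite /isperm.
  have sa : size a = n.
    by case: Aw => /and3P[]; rewrite !size_rcons !eqSS => /eqP.
  have [pw A] := (almost_rcons2 y z sa).1 Aw.
  have [zlt ylt] : z < n.+2 /\ y < n.+2.
    by case/and3P: pw => _ _; rewrite !all_rcons => /and3P[].
  have yz : y != z.
    case/and3P: pw => _; rewrite rcons_uniq mem_rcons inE negb_or eq_sym.
    by case/andP=> /andP[].
  have [ey|yn1] := eqVneq y n.+1.
    subst y; left; have [ez|zn0] := eqVneq z n.
      subst z; left; exists a => //; apply/almost_rcons/almost_rcons1=> //.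
      by split=> //; rewrite -isperm_top.
    right; exists (a, z) => //; split=> /=; last by apply/eqP.
    by apply/almost_rcons1=> //; split=> //; rewrite -isperm_top.
  right; have [ey|yn0] := eqVneq y n.
    subst y; left; have zlt' : z < n by lia.
    have [t et] := isperm_nextE zlt' pw; subst a.
    exists (t, z) => //; split=> /=; last by lia.
    apply/almost_rcons1; first by rewrite size_map in sa.
    by split; [rewrite -isperm_next | apply/excess_bumps].
  have [ez|zn0] := eqVneq z n.
    subst z; right; have ylt' : y < n by lia.
    rewrite (isperm_perm _ (perm_rcons2 _ _ _)) in pw.
    have [t et] := isperm_nextE ylt' pw; subst a.
    exists (t, y) => //; split=> /=; last by lia.
    apply/almost_rcons1; first by rewrite size_map in sa.
    by split; [rewrite -isperm_next | apply/excess_bumps].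
  have zlt' : z < n by lia.
  have n0 : 0 < n by lia.
  (* Here y and z are both below [n], so [n] and [n.+1] lie among the first [n] entries, against the
     condition at position [n.-1]. *)
  have ma x : n <= x -> x < n.+2 -> x \in a.
    move=> xge xlt; have : x \in rcons (rcons a y) z by rewrite (isperm_mem _ pw).
    by rewrite !(mem_rcons, inE) => /or3P[/eqP|/eqP|//]; lia.
  have := A n.-1; rewrite prednK // => /(_ (leqnn n)).
  rewrite /excess take_oversize ?sa ?prednK // -size_filter.
  have /uniq_leq_size H : uniq [:: n; n.+1] by rewrite /= inE; lia.
  have /H /= : {subset [:: n; n.+1] <= [seq x <- a | n <= x]}.
    move=> x; rewrite !inE mem_filter => /orP[]/eqP->; rewrite ma //; lia.
  by move=> h1 h2; have := leq_trans h1 h2.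
case=> [[[t At ->]|[q Oq ->]]|[[q Oq ->]|[q Oq ->]]]; split=> //=; try by lia.
- have sa : size t = n by case: At => /and3P[/eqP].
  apply/almost_rcons2=> //; rewrite isperm_top.
  by apply/(almost_rcons1 _ sa)/almost_rcons.
- have [sa zlt _] := almost_open_pair Oq.
  by apply/almost_rcons2=> //; rewrite isperm_top; apply/almost_rcons1=> //; case: Oq.
- by have [_ zlt _] := almost_open_pair Oq; lia.
- have [sa zlt _] := almost_open_pair Oq.
  apply/almost_rcons2; rewrite ?size_map //; rewrite isperm_next //.
  by rewrite excess_bumps; apply/almost_rcons1=> //; case: Oq.
- by have [_ zlt _] := almost_open_pair Oq; lia.
- have [sa zlt _] := almost_open_pair Oq.
  apply/almost_rcons2; rewrite ?size_map //.
  rewrite (isperm_perm _ (perm_rcons2 _ _ _)) isperm_next //.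
  by rewrite excess_bumps; apply/almost_rcons1=> //; case: Oq.
Qed.

Lemma almost_counted n : counted (almost_counts n).1 (almost n) /\
  counted (almost_counts n).2 (almost_open n).
Proof.
elim: n => [|n] /=.
  split.
    exists [:: [::]]; split=> // w; rewrite inE; split=> [/eqP->|[]].
      by split=> // i; rewrite /excess.
    by case: w.
  by apply: counted0 => q /almost_open_pair[_ ]; rewrite ltn0.
case: (almost_counts n) => x o /= [IHx IHo]; split.
  apply: (@counted_ext _ _ (fun w => (exists2 v, almost n v & w = rcons v n) \/
    (exists2 q, almost_open n q & w = rcons q.1 q.2))).
    apply: counted_or.
    - by apply: counted_image => // u v _ _ /rcons_inj[].
    - by apply: counted_image => // -[t z] [t' z'] _ _ /= /rcons_inj[-> ->].
    by move=> w [v _ ->] [[t z] [_ /= zn] /rcons_inj[_ e]]; apply: zn.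
  move=> w; split=> [Aw|[[v Av ->]|[q [Aq _] ->]]]; last 2 first.
  - exact/almost_rcons.
  - by [].
  case/lastP: w Aw => [[]//|t z Aw]; have [e|zn] := eqVneq z n.
    by left; subst z; exists t => //; apply/almost_rcons.
  by right; exists (t, z) => //; split=> //; apply/eqP.
have -> : x + 3 * o = (x + o) + (o + o) by lia.
apply: counted_ext (almost_openS n); apply: counted_or.
- apply: counted_or.
  + by apply: counted_image => // u v _ _ [/rcons_inj[]].
  + by apply: counted_image => // -[t z] [t1 z1] _ _ /= [/rcons_inj[-> ->]].
  by move=> p [t _ ->] [[t' z] [_ /= zn] [_ e]]; apply: zn.
- apply: counted_or.
  + apply: counted_image => // -[t z] [t' z'] _ _ /= [/rcons_inj[e ->]].
    by rewrite (inj_map (@bump_inj n) e).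
  + apply: counted_image => // -[t z] [t' z'] _ _ /= [/rcons_inj[e ->]].
    by rewrite (inj_map (@bump_inj n) e).
  by move=> p [q /almost_open_pair[_ lt _] ->] [q' _ [_ e]]; lia.
(* The two pairs of families differ in the last entry of the first component: it is [n.+1] in the
   first pair only. *)
have big q : almost_open n q -> q.2 <> n.+1.
  by case/almost_open_pair=> _ lt _; lia.
by move=> p [[t _ ->]|[q _ ->]] [[q' Oq]|[q' Oq]] /(congr1 fst) /rcons_inj[_];
  [lia | move/esym/(big _ Oq) | lia | move/esym/(big _ Oq)].
Qed.

(** * Subsequences and pattern containment *)

(** A strictly increasing list of indices is [iota 0 (size w)] filtered by membership, and mapping
    [nth 0 w] preserves subsequences. *)
Lemma sorted_nth_subseq (w s : seq nat) :
  sorted ltn s -> all (fun i => i < size w) s -> subseq (map (nth 0 w) s) w.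
Proof.
move=> ss /allP sw; rewrite -[X in subseq _ X](mkseq_nth 0 w).
apply: map_subseq; have -> : s = [seq i <- iota 0 (size w) | i \in s].
  apply: (irr_sorted_eq ltn_trans ltnn ss).
    exact/(sorted_filter ltn_trans)/iota_ltn_sorted.
  move=> i; rewrite mem_filter mem_iota /= add0n.
  by case: (boolP (i \in s)) => //= /sw ->.
exact: filter_subseq.
Qed.

Lemma subseq_mapP (T U : eqType) (f : T -> U) s (w : seq T) :
  subseq s (map f w) -> exists2 s', s = map f s' & subseq s' w.
Proof.
case/subseqP=> m _ ->; exists (mask m w); first by rewrite map_mask.
exact: mask_subseq.
Qed.

Lemma subseq_catP (T : eqType) (s u v : seq T) : subseq s (u ++ v) ->
  exists s1 s2, [/\ s = s1 ++ s2, subseq s1 u & subseq s2 v].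
Proof.
case/subseqP=> m sm ->; rewrite -(cat_take_drop (size u) m).
exists (mask (take (size u) m) u), (mask (drop (size u) m) v).
split; rewrite ?mask_subseq // mask_cat // size_takel // sm size_cat.
exact: leq_addr.
Qed.

Lemma subseq2_lt v c d : sorted ltn v -> subseq [:: c; d] v -> c < d.
Proof.
by move=> sv /(subseq_sorted ltn_trans) /(_ sv) /=; rewrite andbT.
Qed.

Lemma sorted_subseq2 v :
  (forall c d, subseq [:: c; d] v -> c < d) -> sorted ltn v.
Proof.
move=> H; rewrite (sorted_pairwise ltn_trans).
elim: v H => //= x v IHv H; rewrite IHv ?andbT; last first.
  by move=> c d cd; apply: H; apply: subseq_trans cd (subseq_cons _ _).
by apply/allP=> d dv; apply: H; rewrite /= eqxx sub1seq.
Qed.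

(** The disjuncts are the order types 2413, 4132, 4213 and 3214, in this order. *)
Definition bad (a b c d : nat) : bool :=
  [|| [&& c < a, a < d & d < b], [&& b < d, d < c & c < a],
      [&& c < b, b < d & d < a] | [&& c < b, b < a & a < d]].

Definition evil (w : seq nat) : Prop :=
  forall a b c d, subseq [:: a; b; c; d] w -> ~~ bad a b c d.

(** Increasing index functions correspond to subsequences; conversely the positions are recovered as
    a subsequence of [enum 'I_n]. *)
Lemma contains_patternP n (s : {perm 'I_n}) p :
  contains_pattern s p <-> exists v, [/\ subseq v (word s), size v = size p &
    forall i j, i < size p -> j < size p ->
      (nth 0 v i < nth 0 v j) = (nth 0 p i < nth 0 p j)].
Proof.
split.
  case/existsP=> f /forallP F.
  have {}F a b := forallP (F a) b.
  exists (map (fun a => val (s (f a))) (enum 'I_(size p))); split.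
  - have -> : map (fun a => val (s (f a))) (enum 'I_(size p)) =
       map (nth 0 (word s)) (map (fun a => val (f a)) (enum 'I_(size p))).
      by rewrite -map_comp; apply: eq_map => a /=; rewrite nth_word.
    apply: sorted_nth_subseq; last first.
      by apply/allP=> x /mapP[a _ ->]; rewrite size_word; apply: ltn_ord.
    rewrite sorted_map; apply: (@sub_sorted _ (relpre val ltn)).
      by move=> a b /= ab; have := F a b; rewrite ab => /andP[].
    by rewrite -sorted_map val_enum_ord iota_ltn_sorted.
  - by rewrite size_map size_enum_ord.
  have N (a : 'I_(size p)) :
      nth 0 [seq val (s (f b)) | b <- enum 'I_(size p)] a = s (f a).
    by rewrite (nth_map a) ?size_enum_ord // nth_ord_enum.
  move=> i j ip jp; rewrite (N (Ordinal ip)) (N (Ordinal jp)).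
  by have /andP[_ /eqP] := F (Ordinal ip) (Ordinal jp).
case=> v [/subseq_mapP[e -> se] sv V]; rewrite size_map in sv.
apply/existsP; exists [ffun a => tnth (in_tuple e) (cast_ord (esym sv) a)].
apply/forallP=> a; apply/forallP=> b; rewrite !ffunE.
(* A default element for [nth]; it exists because the index [a] shows that [e] is nonempty. *)
have x0 : 'I_n by exact: (tnth (in_tuple e) (cast_ord (esym sv) a)).
rewrite !(tnth_nth x0) /=; have := V a b (ltn_ord a) (ltn_ord b).
rewrite !(nth_map x0) ?sv // => ->; rewrite eqxx andbT; apply/implyP=> ab.
have : sorted ltn (map val e).
  have := map_subseq val se; rewrite val_enum_ord => /(subseq_sorted ltn_trans).
  by apply; apply: iota_ltn_sorted.
rewrite sorted_map => S; apply: (sorted_ltn_nth _ x0 S); rewrite ?inE ?sv //.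
by move=> x y z; apply: ltn_trans.
Qed.

Lemma evilE n (s : {perm 'I_n}) : evil_avoiding s <-> evil (word s).
Proof.
have C p0 p1 p2 p3 : contains_pattern s [:: p0; p1; p2; p3] <->
    exists a b c d, subseq [:: a; b; c; d] (word s) /\
    forall i j, i < 4 -> j < 4 -> (nth 0 [:: a; b; c; d] i < nth 0 [:: a; b; c; d] j) =
       (nth 0 [:: p0; p1; p2; p3] i < nth 0 [:: p0; p1; p2; p3] j).
  split.
    case/contains_patternP=> v [sv sz V].
    case: v sz sv V => [|a [|b [|c [|d [|]]]]] // _ sv V.
    by exists a, b, c, d.
  by case=> a [b [c [d [sv V]]]]; apply/contains_patternP; exists [:: a; b; c; d].
split.
  case/and4P=> /negP A /negP B /negP D /negP E a b c d sv; apply/negP=> bd.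
  case/or4P: bd => bd; [case: A | case: B | case: D | case: E]; apply/C;
    exists a, b, c, d; split=> // -[|[|[|[|i]]]] [|[|[|[|j]]]] //= _ _; lia.
move=> E; apply/and4P; split; apply/negP=> /C[a [b [c [d [sv V]]]]];
  have /negP := E _ _ _ _ sv; apply; rewrite /bad;
  move: (V 0 1 isT isT) (V 0 2 isT isT) (V 0 3 isT isT) (V 1 2 isT isT)
   (V 1 3 isT isT) (V 2 3 isT isT) (V 2 1 isT isT) (V 2 0 isT isT)
   (V 1 0 isT isT) (V 3 1 isT isT) (V 3 0 isT isT) (V 3 2 isT isT) => /=; lia.
Qed.

(** * Operations preserving avoidance *)

Lemma evil_sub w w' : subseq w' w -> evil w -> evil w'.
Proof. by move=> s E a b c d /subseq_trans/(_ s); apply: E. Qed.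

Lemma evil_map f w : {mono f : x y / x < y} -> evil (map f w) <-> evil w.
Proof.
move=> fM; have B a b c d : bad (f a) (f b) (f c) (f d) = bad a b c d.
  by rewrite /bad !fM.
split=> E a b c d; first by move/(map_subseq f)/E; rewrite B.
by case/subseq_mapP=> -[|a' [|b' [|c' [|d' [|]]]]] //= [-> -> -> ->] /E; rewrite B.
Qed.

Lemma evil0 w : evil (0 :: w) <-> evil w.
Proof.
split; first by apply: evil_sub; apply: subseq_cons.
move=> E a b c d; rewrite [subseq _ _]/=; case: eqP => [-> _|_]; last exact: E.
by rewrite /bad; lia.
Qed.

(** None of the four patterns has a nonempty suffix that increases and lies below its remaining
    entries, so an occurrence must stay inside [u]. *)
Lemma evil_cat_low u v : evil u -> sorted ltn v ->
  (forall x y, x \in u -> y \in v -> y < x) -> evil (u ++ v).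
Proof.
move=> E sv uv a b c d /subseq_catP[s1 [s2 [+ /[dup] u1 /mem_subseq m1]]].
move=> + /[dup] v2 /mem_subseq m2.
have ss := subseq_sorted ltn_trans v2 sv.
case: s1 u1 m1 => [|a1 [|b1 [|c1 [|d1 [|]]]]] u1 m1 //= e.
- by rewrite -{}e /= in ss; rewrite /bad; lia.
- case: e ss m2 => -> <- /= ss m2.
  have := uv a1 b; have := uv a1 c; have := uv a1 d.
  rewrite m1 ?m2 ?inE ?eqxx ?orbT // => /(_ isT isT) ? /(_ isT isT) ? /(_ isT isT) ?.
  rewrite /bad; lia.
- case: e ss m2 => -> -> <- /= ss m2.
  have := uv b1 c; have := uv b1 d; have := uv a1 c; have := uv a1 d.
  rewrite !m1 ?m2 ?inE ?eqxx ?orbT //.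
  move=> /(_ isT isT) ? /(_ isT isT) ? /(_ isT isT) ? /(_ isT isT) ?.
  rewrite /bad; lia.
- case: e ss m2 => -> -> -> <- /= ss m2.
  have := uv a1 d; have := uv b1 d; have := uv c1 d.
  rewrite !m1 ?m2 ?inE ?eqxx ?orbT //.
  move=> /(_ isT isT) ? /(_ isT isT) ? /(_ isT isT) ?.
  rewrite /bad; lia.
by case: e u1 => -> -> -> -> _; apply: E.
Qed.

(** In [u ++ v] an entry below [x] is followed only by larger entries, still below [x]. Each pattern
    starting at [x] needs a descent below [x] or a rise from below [x] to above it. No pattern
    starts with its minimum, so 0 cannot come first. *)
Lemma evil_spread x u v : evil u -> sorted ltn v ->
  (forall y, y \in u -> x < y) -> (forall y, y \in v -> y < x) ->
  evil (x :: 0 :: u ++ v).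
Proof.
move=> E sv ux vx.
have Euv : evil (u ++ v).
  by apply: evil_cat_low => // y z /ux xy /vx; move/ltn_trans; apply.
have S c d : subseq [:: c; d] (u ++ v) -> c < x -> c < d < x.
  case/subseq_catP=> -[|c1 s1] [s2 []] /=.
    move=> <- _ cd _; rewrite (subseq2_lt sv cd) vx //.
    by rewrite (mem_subseq cd) // !inE eqxx orbT.
  by case=> -> _ /mem_subseq/(_ c1 (mem_head _ _))/ux; lia.
have xne y : y \in u ++ v -> y != x.
  by rewrite mem_cat => /orP[/ux|/vx]; lia.
move=> a b c d; rewrite [subseq _ _]/=; case: eqP => [->|_]; last first.
  by case: eqP => [-> _|_ /Euv//]; rewrite /bad; lia.
case: eqP => [-> cd|_ bcd]; first by have := S _ _ cd; rewrite /bad; lia.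
have bc : subseq [:: b; c] (u ++ v).
  by apply: subseq_trans bcd; rewrite (prefix_subseq [:: b; c] [:: d]).
have cd : subseq [:: c; d] (u ++ v).
  by apply: subseq_trans bcd; apply: subseq_cons.
by have := S _ _ bc; have := S _ _ cd; rewrite /bad; lia.
Qed.

(** * Decomposition at the entry 0 *)

Definition evil_perm (n : nat) (w : seq nat) : Prop := isperm n w /\ evil w.

(* The words u 0 1 ... (k-1) with all values of u at least k, encoded by k and
   the standardization of u. *)
Definition high_low (q : nat * seq nat) : seq nat := map (addn q.1) q.2 ++ iota 0 q.1.

Definition split_pair (n : nat) (q : nat * seq nat) : Prop :=
  [/\ 0 < q.1, 0 < size q.2, q.1 + size q.2 = n & evil_perm (size q.2) q.2].

(* The pair (x, t) stands for the word x :: t. *)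
Definition straddling (n : nat) (q : nat * seq nat) : Prop :=
  evil_perm n (q.1 :: q.2) /\
  exists y, [/\ 0 < q.1, q.1 < y & subseq [:: 0; y] q.2].

Lemma perm_iota n w : isperm n w -> perm_eq w (iota 0 n).
Proof.
move=> pw; have /and3P[_ uw _] := pw.
by apply: uniq_perm; rewrite ?iota_uniq // => x; rewrite (isperm_mem _ pw) mem_iota.
Qed.

Lemma addn_lt k : {mono addn k : x y / x < y}.
Proof. by move=> x y; rewrite ltn_add2l. Qed.

Lemma isperm_high_low k m u :
  isperm m u -> isperm (k + m) (map (addn k) u ++ iota 0 k).
Proof.
case/and3P=> /eqP su uu /allP au; rewrite /isperm size_cat size_map size_iota su addnC eqxx.
rewrite cat_uniq (map_inj_uniq (@addnI k)) uu iota_uniq andbT /= all_cat.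
apply/and3P; split.
- apply/hasPn=> x; rewrite mem_iota => xk; apply/mapP=> -[y _ e]; lia.
- by rewrite all_map; apply/allP=> x /au /=; lia.
by apply/allP=> x; rewrite mem_iota /=; lia.
Qed.

(** [v] followed by the sorted [u] is the sorted list of all values, so [v] is its initial
    segment. *)
Lemma high_lowE n u v : isperm n (u ++ v) -> sorted ltn v ->
  (forall x y, x \in u -> y \in v -> y < x) ->
  v = iota 0 (size v) /\
  exists2 u', isperm (size u') u' & u = map (addn (size v)) u'.
Proof.
move=> pw sv uv; set k := size v.
have eq_iota : v ++ sort leq u = iota 0 n.
  apply: (sorted_eq leq_trans anti_leq); rewrite ?iota_sorted //.
    rewrite (sorted_pairwise leq_trans) pairwise_cat.
    rewrite -!(sorted_pairwise leq_trans) sort_sorted ?andbT; last exact: leq_total.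
    apply/andP; split.
      apply/allrelP=> y x yv; rewrite mem_sort => xu.
      by apply/ltnW/uv.
    by apply: sub_sorted sv => x y /ltnW.
  apply: perm_trans (perm_iota pw); rewrite perm_catC.
  by rewrite perm_cat2r perm_sort.
have kn : k <= n.
  by have := congr1 size eq_iota; rewrite size_cat size_iota => <-; apply: leq_addr.
have ev : v = iota 0 k.
  by rewrite -(take_size_cat (sort leq u) (erefl k)) eq_iota take_iota; congr iota; lia.
have eu : sort leq u = iota k (n - k).
  by rewrite -(drop_size_cat (sort leq u) (erefl k)) eq_iota drop_iota.
have mu x : (x \in u) = (k <= x < n).
  by rewrite -(mem_sort leq) eu mem_iota subnKC.
split=> //; exists (map (subn^~ k) u).
  rewrite /isperm eqxx /= size_map.
  rewrite map_inj_in_uniq; last by move=> x y; rewrite !mu; lia.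
  have -> : uniq u by case/and3P: pw => _; rewrite cat_uniq => /andP[].
  have -> : size u = n - k by rewrite -(size_sort leq) eu size_iota.
  by rewrite all_map; apply/allP=> x; rewrite mu /=; lia.
rewrite -map_comp map_id_in // => x; rewrite mu /=; lia.
Qed.

Lemma isperm_shuffle n (u v : seq nat) x : isperm n (u ++ x :: v) = isperm n (x :: u ++ v).
Proof. by apply: isperm_perm; apply: permEl (perm_catCA u [:: x] v). Qed.

Lemma evil_perm_cons n x w : evil_perm n.+1 (x :: w) ->
  exists2 t, evil_perm n t & w = map (bump x) t.
Proof.
case=> pw E; have [t pt et] := isperm_cons pw; exists t; rewrite // et in E *.
split=> //; apply/(evil_map _ (@bump_lt x)); apply: evil_sub E.
exact: subseq_cons.
Qed.

Lemma map_bump0 w : map (bump 0) w = map S w.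
Proof. by apply: eq_map => x; rewrite /bump add1n. Qed.

Lemma subseq_ends (T : eqType) (x y : T) a b : y \in b -> subseq [:: x; y] (a ++ x :: b).
Proof.
move=> yb; apply: (@cat_subseq _ [::] [:: x; y]); first exact: sub0seq.
by rewrite /= eqxx sub1seq.
Qed.

Lemma mem_split (T : eqType) (x : T) s : x \in s -> exists a b, s = a ++ x :: b.
Proof. by case/splitPr=> a b; exists a, b. Qed.

Lemma high_low_evil n q : split_pair n q -> evil_perm n (high_low q).
Proof.
case=> _ _ <- [pu E]; split; first exact: isperm_high_low.
apply: evil_cat_low; rewrite ?iota_ltn_sorted //.
  by apply/(evil_map _ (@addn_lt q.1)).
by move=> x y /mapP[z _ ->]; rewrite mem_iota; lia.
Qed.

(** The cases are: 0 comes first; some entry after 0 exceeds the first entry x; no such entry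
    exists. In the last case avoidance forces an upper block before 0 and an increasing lower block
    from 0 on. *)
Lemma evil_permS n w : evil_perm n.+1 w <->
  (exists2 v, evil_perm n v & w = 0 :: map S v) \/
  ((exists2 q, split_pair n.+1 q & w = high_low q) \/
   (exists2 q, straddling n.+1 q & w = q.1 :: q.2)).
Proof.
split; last first.
  case=> [[v [pv Ev] ->]|[[q /high_low_evil Hq ->]//|[q [Eq _] ->]//]].
  rewrite -map_bump0; split; first by rewrite isperm_bump.
  by apply/evil0/(evil_map _ (@bump_lt 0)).
case: w => [|x t] Ew; first by case: Ew.
have [x0|x_gt0] := posnP x.
  subst x; left; have [v Hv ->] := evil_perm_cons Ew.
  by exists v; rewrite // map_bump0.
right; have [pw E] := Ew; have /mem_split[a [b et]] : 0 \in t.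
  have : 0 \in x :: t by rewrite (isperm_mem _ pw).
  by rewrite inE; case: eqP => // e; lia.
subst t; have [/hasP[y yb xy]|/hasPn nb] := boolP (has (fun y => x < y) b).
  right; exists (x, a ++ 0 :: b) => //; split=> //; exists y; split=> //.
  exact: subseq_ends.
left; have /and3P[_ uw _] := pw.
have bx y : y \in b -> 0 < y < x.
  move=> yb; move: uw; rewrite /= mem_cat inE cat_uniq /=.
  have [e|yx] := eqVneq y x; first by rewrite -e yb !orbT.
  have [e|y0] := eqVneq y 0; first by rewrite -e yb !andbF.
  by have := nb y yb; lia.
(* A descent c d in [b] would make x 0 c d a 4132. *)
have sb : sorted ltn b.
  apply: sorted_subseq2 => c d cd.
  have cb : c \in b by apply: (mem_subseq cd); rewrite mem_head.
  have db : d \in b by apply: (mem_subseq cd); rewrite !inE eqxx orbT.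
  have := E x 0 c d; have := bx c cb; have := bx d db.
  have c_ne_d : c != d.
    have /subseq_uniq/(_ _) : subseq [:: c; d] (x :: a ++ 0 :: b).
      apply: subseq_trans cd _; rewrite -cat_rcons -cat_cons; exact: suffix_subseq.
    by move/(_ uw); rewrite /= inE andbT.
  have -> : subseq [:: x; 0; c; d] (x :: a ++ 0 :: b).
    rewrite [subseq _ _]/= eqxx.
    apply: (@cat_subseq _ [::] [:: 0; c; d]); first exact: sub0seq.
    by rewrite [subseq _ _]/=.
  move=> h1 h2 /(_ isT); rewrite /bad; lia.
have [||e0 [u pu eu]] := @high_lowE n.+1 (x :: a) (0 :: b) pw.
- rewrite /= path_min_sorted //; apply/allP=> y /bx /andP[] //.
- move=> z y; rewrite !inE => zu yb.
  have [ez|zx] := eqVneq z x.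
    by case/orP: yb => [/eqP->|/bx]; rewrite ez //; lia.
  have za : z \in a by case/orP: zu => // /eqP e; rewrite e eqxx in zx.
  have z0 : 0 < z.
    rewrite lt0n; apply: contraL uw => /eqP e.
    by rewrite e in za; rewrite /= cat_uniq /= za /= !andbF.
  case/orP: yb => [/eqP->//|yb]; have /andP[y0 yx] := bx _ yb.
  have zy : z != y.
    apply: contraL uw => /eqP e; rewrite /= cat_uniq negb_and.
    apply/orP; right; rewrite negb_and; apply/orP; right; rewrite negb_and.
    by apply/orP; left; rewrite negbK; apply/hasP; exists z; rewrite // inE e yb orbT.
  (* If z were below y, then x z 0 y would be a 4213. *)
  have := E x z 0 y.
  have -> : subseq [:: x; z; 0; y] (x :: a ++ 0 :: b).
    rewrite [subseq _ _]/= eqxx.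
    apply: (@cat_subseq _ [:: z] [:: 0; y]); first by rewrite sub1seq.
    by rewrite /= sub1seq.
  move=> /(_ isT); rewrite /bad; lia.
exists ((size b).+1, u); last by rewrite /high_low /= -eu -cat_cons {1}e0.
have su : size u = (size a).+1 by rewrite -(size_map (addn (size b).+1)) -eu.
split; rewrite ?su //=.
  by case/and3P: pw => /eqP; rewrite /= size_cat /=; lia.
rewrite -su; split=> //; apply/(evil_map _ (@addn_lt (size b).+1)).
rewrite -eu; apply: evil_sub E; rewrite -cat_cons; exact: prefix_subseq.
Qed.

(** * Reduction of straddling words *)

(** Reduces the search for pattern occurrences to inequalities between positions. *)
Lemma index_subseq (w s : seq nat) :
  sorted ltn (map (index^~ w) s) -> all (mem w) s -> subseq s w.
Proof.
move=> ss /allP sw; have -> : s = map (nth 0 w) (map (index^~ w) s).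
  by rewrite -map_comp map_id_in // => x /sw xw /=; rewrite nth_index.
apply: sorted_nth_subseq => //; apply/allP=> _ /mapP[x /sw xw ->].
by rewrite index_mem.
Qed.

Lemma subseq2_index (w : seq nat) x y : uniq w -> subseq [:: x; y] w ->
  [/\ x \in w, y \in w & index x w < index y w].
Proof.
move=> uw xy; have m := mem_subseq xy.
have xw : x \in w by rewrite m // inE eqxx.
have yw : y \in w by rewrite m // !inE eqxx orbT.
split=> //; case/splitPr: xw uw xy yw {m} => a b uw.
rewrite (uniq_subseq_pivot [::] [:: y] uw) sub0seq sub1seq /= => yb _.
move: uw; rewrite cat_uniq /= negb_or => /and3P[_ /andP[xa /hasPn/(_ y yb) ya]].
case/andP=> xb _; rewrite !index_cat (negPf xa) (negPf ya) /= eqxx.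
by case: eqP => [e|_]; [rewrite e yb in xb | lia].
Qed.

(** No value lies between x and x+1, so in an occurrence starting at x one may replace x by x+1. If
    both are used, they form an initial ascent, which only 2413 has, and that needs a value in
    between. *)
Lemma straddling_dup n q : straddling n q ->
  straddling n.+1 (q.1, q.1.+1 :: map (bump q.1) q.2).
Proof.
case: q => x t [/= [pw E] [y [x0 xy sy]]].
have xt : x \notin t by case/and3P: pw => _ /andP[].
have bx : map (bump x) (x :: t) = x.+1 :: map (bump x) t.
  by rewrite /= [bump x x]/bump leqnn.
have E' : evil (x.+1 :: map (bump x) t).
  by rewrite -bx; apply/(evil_map _ (@bump_lt x)).
split=> /=; last first.
  exists y.+1; split=> //; first by lia.
  have := map_subseq (bump x) sy; rewrite /= /bump (leqNgt x 0) x0 (ltnW xy) add1n add0n => s.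
  exact: s.
split; first by rewrite -bx isperm_bump // ltnW // -(isperm_mem x pw) mem_head.
move=> a b c d; rewrite [subseq _ _]/=; case: eqP => [->|_]; last first.
  exact: E'.
case: eqP => [-> _|_ bcd]; first by rewrite /bad; lia.
have : ~~ bad x.+1 b c d by apply: E'; rewrite /= eqxx.
have N z : z \in [:: b; c; d] -> z != x /\ z != x.+1.
  move/(mem_subseq bcd)/mapP=> [z' z't ->].
  have : z' != x by apply: contraNneq xt => <-.
  by rewrite /bump; lia.
have := N b; have := N c; have := N d; rewrite !inE !eqxx !orbT.
by move=> /(_ isT) ? /(_ isT) ? /(_ isT) ?; rewrite /bad; lia.
Qed.

(* If c preceded 0, then x c 0 y would form the pattern 3214; hence a descent
   c d below x would form 4132 with x and 0. *)
Lemma straddling_low n x t c d : straddling n (x, t) ->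
  subseq [:: c; d] t -> c < x -> c < d.
Proof.
case=> [/= [pw E] [y [x0 xy sy]]] scd cx.
have /and3P[_ /= /andP[_ ut] _] := pw.
have [ct dt cd] := subseq2_index ut scd.
have [zt yt zy] := subseq2_index ut sy.
have [c0|c0] := posnP c.
  by rewrite c0 lt0n; apply: contraTneq cd => ->; rewrite c0 ltnn.
have cz : index c t <> index 0 t.
  by move=> /(congr1 (nth 0 t)); rewrite !nth_index //; lia.
have cned : c <> d by move=> e; rewrite e ltnn in cd.
have [c_lt|c_ge] := ltnP (index c t) (index 0 t).
  have := E x c 0 y; rewrite [subseq _ _]/= eqxx index_subseq /= ?ct ?zt ?yt //.
    by move=> /(_ isT); rewrite /bad; lia.
  by rewrite c_lt zy.
have d0 : d <> 0 by move=> e; rewrite e in cd; lia.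
have := E x 0 c d; rewrite [subseq _ _]/= eqxx index_subseq /= ?ct ?zt ?dt //.
  by move=> /(_ isT); rewrite /bad; lia.
have zc : index 0 t < index c t by lia.
by rewrite zc cd.
Qed.

(** A new occurrence must start with x+1 followed by the inserted 0. Only 4132 has its minimum
    second, and it would need a descent below x, excluded by [straddling_low]. *)
Lemma straddling_ins0 n q : straddling n q ->
  straddling n.+1 (q.1.+1, 0 :: map S q.2).
Proof.
case: q => x t S0; have [/= [pw E] [y [x0 xy sy]]] := S0; split=> /=; last first.
  exists y.+1; split=> //; rewrite /= sub1seq map_f //.
  by rewrite (mem_subseq sy) // !inE eqxx orbT.
split.
  rewrite (isperm_shuffle _ [:: x.+1]) /=.
  by have := isperm_bump (x :: t) (leq0n n); rewrite map_bump0 /= pw.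
have E' : evil (map S (x :: t)) by rewrite -map_bump0; apply/(evil_map _ (@bump_lt 0)).
move=> a b c d; rewrite [subseq _ _]/=; case: eqP => [->|_]; last first.
  case: eqP => [-> _|_ h]; first by rewrite /bad; lia.
  exact/E'/(subseq_trans h)/subseq_cons.
case: eqP => [-> /subseq_mapP[[|c' [|d' []]] // [-> ->] cd]|_ h].
  by have := straddling_low S0 cd; rewrite /bad; lia.
by apply: E'; rewrite /= eqxx.
Qed.

(** The word has the shape treated in [evil_spread]. Its values are those of
    [high_low (k, 0 :: map S u)], whose least upper value is [k]. *)
Lemma straddling_spread n q : split_pair n q ->
  straddling n.+1 (q.1, 0 :: map (addn q.1.+1) q.2 ++ iota 1 q.1.-1).
Proof.
case: q => k u [/= k0 u0 <- [pu E]]; split=> /=; last first.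
  case: u u0 {pu E} => // y u _; exists (k.+1 + y); split=> //; first by lia.
  by rewrite /= eqxx sub0seq.
split.
  have := isperm_bump u (leq0n (size u)); rewrite pu => /(isperm_high_low k).
  rewrite addnS map_bump0 => h; apply: etrans h; apply: isperm_perm.
  rewrite /= addn0 perm_cons -map_comp.
  have -> : iota 0 k = 0 :: iota 1 k.-1 by case: (k) k0.
  rewrite (eq_map (g := addn k \o S)); last by move=> x /=; rewrite addSnnS.
  by rewrite perm_sym -cat1s perm_catCA.
apply: evil_spread; rewrite ?iota_ltn_sorted //.
- by apply/(evil_map _ (@addn_lt k.+1)).
- by move=> y /mapP[z _ ->]; lia.
by move=> y; rewrite mem_iota; lia.
Qed.

Lemma split_sep (T : eqType) (P : pred T) w :
  (forall z y, subseq [:: z; y] w -> P y -> P z) ->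
  w = filter P w ++ filter (predC P) w.
Proof.
elim: w => //= h w IHw H.
have {}IHw := IHw (fun z y s => H z y (subseq_trans s (subseq_cons _ _))).
case Ph: (P h) => /=; first by rewrite -IHw.
have N : {in w, P =1 pred0}.
  move=> y yw; apply: contraFF Ph; apply: H.
  by rewrite eqxx sub1seq.
rewrite (eq_in_filter N) filter_pred0 /= (eq_in_filter (a2 := predT)) ?filter_predT //.
by move=> y /N /= ->.
Qed.

(** The second entry can only be x+1, so x and x+1 begin a run and x can be deleted. *)
Lemma straddling_double n x z t : 0 < z -> straddling n.+1 (x, z :: t) ->
  exists2 t', straddling n (x, t') & z :: t = x.+1 :: map (bump x) t'.
Proof.
move=> z0 [/= Ew [y [x0 xy]]]; case: eqP => [e|_ sy]; first by lia.
have [pw E] := Ew; have /and3P[_ /= /andP[+ /andP[zt ut]] _] := pw.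
rewrite inE negb_or => /andP[/eqP xz xt].
have [zt0 yt zy] := subseq2_index ut sy.
have zney : z <> y by move=> e; rewrite e yt in zt.
(* Avoiding 2413 and 3214 on x z 0 y forces x < z < y. *)
have := E x z 0 y; rewrite /= !eqxx sy => /(_ isT) b1.
have ez : z = x.+1.
  apply/eqP; apply: contraT => zx1.
  have lt1 : x.+1 < y by rewrite /bad in b1; lia.
  have : x.+1 \in [:: x, z & t].
    rewrite (isperm_mem _ pw).
    have : y \in [:: x, z & t] by rewrite !inE yt !orbT.
    by rewrite (isperm_mem _ pw); apply: ltn_trans.
  rewrite !inE eq_sym in zx1 *; rewrite (negPf zx1) (gtn_eqF (ltnSn x)) /= => mt.
  (* If x+1 comes before 0, then z, x+1, 0, y is a 3214; if after, then x, z, 0, x+1 is a 2413. *)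
  have [mlt|mge] := ltnP (index x.+1 t) (index 0 t).
    have := E z x.+1 0 y; rewrite [subseq _ _]/=.
    case: eqP => [e|_]; first by case: xz.
    rewrite eqxx index_subseq /= ?mt ?zt0 ?yt ?mlt ?zy // => /(_ isT).
    by move: b1; rewrite /bad; lia.
  have zm : index 0 t < index x.+1 t.
    have : index 0 t <> index x.+1 t; last by lia.
    by move=> /(congr1 (nth 0 t)); rewrite !nth_index.
  have := E x z 0 x.+1; rewrite [subseq _ _]/= !eqxx.
  rewrite index_subseq /= ?mt ?zt0 ?zm // => /(_ isT).
  by move: b1; rewrite /bad; lia.
(* Deleting x and standardizing turns x+1 into x, and the large value y into y-1. *)
have [[|z' t'] [pt Et] et] := evil_perm_cons Ew; first by [].
have ez' : z' = x by move: et; rewrite ez => -[+ _]; rewrite /bump; lia.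
subst z'; exists t'; last by case: et => _ ->; rewrite ez.
split=> //; have xy1 : x.+1 < y by move: b1; rewrite /bad; lia.
exists y.-1; split=> //=; first by lia.
case: et sy => _ -> /subseq_mapP[[|a [|b []]] // [ea eb]].
have -> : a = 0 by move: ea; rewrite /bump; lia.
by have -> : b = y.-1 by move: eb; rewrite /bump; lia.
Qed.

(** After deletion of 0 the value 1 takes its role, so the word stays straddling exactly if some
    value above x follows 1. Otherwise all values above x precede all those of [t] below x. *)
Lemma straddling_zero n x t : straddling n.+1 (x, 0 :: t) ->
  (exists2 q, straddling n q & (x, 0 :: t) = (q.1.+1, 0 :: map S q.2)) \/
  (exists2 q, split_pair n q &
    (x, 0 :: t) = (q.1, 0 :: map (addn q.1.+1) q.2 ++ iota 1 q.1.-1)).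
Proof.
case=> [/= Ew [y0 [x0 xy0]]]; rewrite sub1seq => y0t.
have [pw E] := Ew; have /and3P[_ /= /andP[xt /andP[zt ut]] _] := pw.
have {}xt : x \notin t by apply: contra xt; rewrite inE orbC => ->.
have low c d : subseq [:: c; d] t -> c < x -> c < d.
  move=> cd cx; have := E x 0 c d; rewrite /= eqxx cd => /(_ isT).
  have [ct dt cd'] := subseq2_index ut cd.
  have d0 : d <> 0 by move=> e; rewrite -e dt in zt.
  have cned : c <> d by move=> e; rewrite e ltnn in cd'.
  by rewrite /bad; lia.
have [/hasP[y yt /andP[xy sy]]|/hasPn N] :=
    boolP (has (fun y => (x < y) && subseq [:: 1; y] t) t).
  have x1 : 1 < x.
    have [m _ _] := subseq2_index ut sy.
    by rewrite ltn_neqAle x0 andbT; apply: contraNneq xt => <-.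
  (* 0 is moved to the front so that [evil_perm_cons] deletes it. *)
  have Ew0 : evil_perm n.+1 (0 :: x :: t).
    split; first by rewrite -[_ :: _]/(0 :: [:: x] ++ t) -isperm_shuffle.
    apply/evil0; apply: evil_sub E.
    exact: (@cat_subseq _ [:: x] t [:: x] _ (subseq_refl _) (subseq_cons _ _)).
  left; have [[|x' t'] [pt Et]] := evil_perm_cons Ew0; first by [].
  rewrite map_bump0 => -[ex et]; exists (x', t'); last by rewrite ex et.
  split=> //=; exists y.-1; split; [by lia | by lia |].
  move: sy; rewrite et => /subseq_mapP[[|a [|b []]] // [ea eb]].
  by case: ea => <-; rewrite eb.
right.
have et : t = [seq y <- t | x < y] ++ [seq y <- t | y < x].
  rewrite {1}[t](split_sep (P := ltn x)); first congr (_ ++ _).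
    apply: eq_in_filter => y yt /=; rewrite -leqNgt leq_eqVlt.
    by case: eqP => // e; rewrite -e yt in xt.
  move=> z y zy /= xy; rewrite ltnNge; apply/negP=> zx.
  have [z_t y_t zy'] := subseq2_index ut zy.
  have {zx} zx : z < x.
    by rewrite ltn_neqAle zx andbT; apply: contraNneq xt => <-.
  have z0 : z != 0 by apply: contraNneq zt => <-.
  have onet : 1 \in t.
    have : 1 \in [:: x, 0 & t].
      rewrite (isperm_mem _ pw); apply: leq_ltn_trans (_ : z < _); first by lia.
      by rewrite -(isperm_mem _ pw) !inE z_t !orbT.
    rewrite !inE => /orP[/eqP|//]; lia.
  have := N _ y_t; rewrite xy /= => /negP; apply.
  have z1 : z <> 1 by move=> e; have := N _ y_t; rewrite xy -e zy.
  (* The values of [t] below x increase, so 1 precedes z and hence y, against the case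
     assumption. *)
  have iz : index 1 t < index z t.
    rewrite ltnNge leq_eqVlt; apply/negP=> /orP[/eqP|] h.
      by have := congr1 (nth 0 t) h; rewrite !nth_index.
    have /low : subseq [:: z; 1] t by rewrite index_subseq //= ?h ?z_t ?onet.
    by move=> /(_ zx); lia.
  by rewrite index_subseq //= ?onet ?y_t // (ltn_trans iz zy').
set p := [seq y <- t | x < y] in et; set r := [seq y <- t | y < x] in et.
have sr : sorted ltn r.
  apply: sorted_subseq2 => c d cd; apply: low.
    exact: subseq_trans cd (filter_subseq _ _).
  have : c \in r by rewrite (mem_subseq cd) // mem_head.
  by rewrite mem_filter => /andP[].
have r0 : all (ltn 0) r.
  apply/allP=> y; rewrite mem_filter /= lt0n => /andP[_].
  by apply: contraTneq => ->.
have px y : y \in p -> x < y by rewrite mem_filter => /andP[].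
have rx y : y \in r -> y < x by rewrite mem_filter => /andP[].
(* Moving 0 behind [p] gives x p 0 r, an upper block followed by an increasing lower one. *)
have [|||e0 [u pu eu]] := @high_lowE n.+1 (x :: p) (0 :: r).
- by rewrite isperm_shuffle -(isperm_shuffle n.+1 [:: x] (p ++ r)) -et.
- by rewrite /= path_min_sorted.
- move=> z y; rewrite !inE => /orP[/eqP->|/px xz] /orP[/eqP->|/rx yx] //; lia.
move: eu; rewrite /=; set k := (size r).+1 => eu.
case: u pu eu => // x' u pu [ex eu].
(* x lies below all of [p], so it is the least value [k] of the upper block. *)
have x'0 : x' = 0.
  have [//|x'gt] := posnP x'.
  have : 0 \in x' :: u by rewrite (isperm_mem _ pu).
  rewrite inE ltn_eqF //= => u0.
  have : k \in p by rewrite eu; apply/mapP; exists 0; rewrite ?addn0.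
  by move/px; lia.
subst x'; rewrite addn0 in ex.
have [v pv ev] := isperm_cons pu; rewrite map_bump0 in ev.
have ep : p = map (addn x.+1) v.
  by rewrite eu ev -map_comp ex; apply: eq_map => y /=; rewrite addnS.
have sv : size u = size v by rewrite ev size_map.
have sp : size p = size v by rewrite ep size_map.
have ltv : 0 < size v.
  by rewrite -sp -has_predT; apply/hasP; exists y0; rewrite // mem_filter xy0.
exists (x, v); last first.
  by rewrite /= -ep et; case: e0; rewrite /k in ex; rewrite ex /= => <-.
split=> //=.
  case/and3P: pw => /eqP; rewrite /= et size_cat sp => -[<-] _ _.
  by rewrite ex /k; lia.
split; first by rewrite -sv.
apply/(evil_map _ (@addn_lt x.+1)); rewrite -ep; apply: evil_sub E.
apply: subseq_trans (filter_subseq _ _) _.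
exact: subseq_trans (subseq_cons _ _) (subseq_cons _ _).
Qed.

Lemma straddlingS n p : straddling n.+1 p <->
  (exists2 q, straddling n q & p = (q.1, q.1.+1 :: map (bump q.1) q.2)) \/
  ((exists2 q, straddling n q & p = (q.1.+1, 0 :: map S q.2)) \/
   (exists2 q, split_pair n q &
      p = (q.1, 0 :: map (addn q.1.+1) q.2 ++ iota 1 q.1.-1))).
Proof.
split; last first.
  case=> [[q Sq ->]|[[q Sq ->]|[q Sq ->]]].
  - exact: straddling_dup.
  - exact: straddling_ins0.
  exact: straddling_spread.
case: p => x [|[|z] t] Sp; first by case: Sp => _ [y []].
  by right; apply: straddling_zero.
left; have [//|t' St ->] := straddling_double _ Sp.
by exists (x, t').
Qed.

(** * Recursion for the evil-avoiding counts *)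

(** Either the lower block is the single entry 0 and the upper part is arbitrary, or the lower block
    can be shortened by one. *)
Lemma split_pairS n q : split_pair n.+2 q <->
  (exists2 u, evil_perm n.+1 u & q = (1, u)) \/
  (exists2 q', split_pair n.+1 q' & q = (q'.1.+1, q'.2)).
Proof.
split; last first.
  case=> [[u Eu ->]|[[k u] [/= k0 u0 <- Eu] ->]].
    by have [/and3P[/eqP su _ _] _] := Eu; split; rewrite ?su.
  by split=> //=; rewrite addSn.
case: q => -[|[|k]] u [//= _ u0 e Eu].
  have su : size u = n.+1 by case: e.
  by left; exists u; rewrite // -su.
by right; exists (k.+1, u) => //; split=> //=; lia.
Qed.

Lemma cat_injl (T : eqType) (s1 s2 t1 t2 : seq T) :
  size t1 = size t2 -> s1 ++ t1 = s2 ++ t2 -> s1 = s2.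
Proof.
move=> st e; have ss : size s1 = size s2.
  by have := congr1 size e; rewrite !size_cat st => /addIn.
by move/eqP: e; rewrite eqseq_cat // => /andP[/eqP].
Qed.

Lemma subseq2_cat_mem (T : eqType) (c d : T) u v :
  subseq [:: c; d] (u ++ v) -> c \notin u -> d \in v.
Proof.
case/subseq_catP=> -[|x s1] [s2 [e su sv]] cu.
  by rewrite (mem_subseq sv) // -[s2]/([::] ++ s2) -e !inE eqxx orbT.
by case: e cu => -> _; rewrite (mem_subseq su) // mem_head.
Qed.

(** The last entry is k-1, which determines the cut. *)
Lemma high_low_inj n q q' : split_pair n q -> split_pair n q' ->
  high_low q = high_low q' -> q = q'.
Proof.
case: q q' => [[|k] u] [[|k'] u'] [//= _ _ _ _] [//= _ _ _ _]; rewrite /high_low.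
move=> /[dup] e /(congr1 (last 0)); rewrite !last_cat -!nth_last !size_iota.
rewrite !nth_iota //= !add0n => ek; subst k'; congr pair.
by move/cat_injl: e => /(_ (erefl _))/(inj_map (@addnI _)).
Qed.

(** [e] and [h] refer to size [n.+1], one more than the first count, as the open words do. Only
    their sum is prescribed, but the induction needs them separately. *)
Lemma evil_counted n : exists e h,
  [/\ counted (almost_counts n).1 (evil_perm n), counted e (split_pair n.+1),
      counted h (straddling n.+1) & e + h = (almost_counts n).2].
Proof.
elim: n => [|n [e [h]]] /=.
  exists 0, 0; split=> //.
  - exists [:: [::]]; split=> // w; rewrite inE; split=> [/eqP->|[]].
      by split=> // a b c d; rewrite subseq0.
    by case: w.
  - by apply: counted0 => -[k u] [/=]; lia.
  by apply: counted0 => -[x [|z t]] [[/= pw _] [y [_ _ s]]].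
case: (almost_counts n) => x o /= [cE cS cH <-].
have cE1 : counted (x + (e + h)) (evil_perm n.+1).
  apply: counted_ext (@evil_permS n); apply: counted_or.
  - by apply: counted_image cE _ => u v _ _ [/(inj_map succn_inj)].
  - apply: counted_or.
    + exact: counted_image cS (@high_low_inj n.+1).
    + by apply: counted_image cH _ => -[a t] [a' t'] _ _ [-> ->].
    (* In a word given by [high_low] every entry after 0 is below the first entry, so it is not
       straddling. *)
    move=> w [[[|k] [|y u]] [//= _ _ _ _] ->] [[a t] [_ [b [/= _ ab s]]]].
    rewrite /high_low => -[ea et]; move: s; rewrite -et => /subseq2_cat_mem.
    have -> : 0 \notin map (addn k.+1) u by apply/mapP=> -[z _]; lia.
    by move=> /(_ isT); rewrite -[0 :: _]/(iota 0 k.+1) mem_iota; lia.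
  move=> w [v _ ->] [[[k u] [/= k0 u0 _ _]]|[[a t] [_ [b [/= a0 _ _]]]]].
    by case: u u0 => // y u _ []; lia.
  by case=> e0; lia.
exists (x + (e + h) + e), (h + (h + e)); split=> //; last by lia.
- apply: counted_ext (@split_pairS n); apply: counted_or.
  + by apply: counted_image cE1 _ => u v _ _ [].
  + by apply: counted_image cS _ => -[k u] [k' u'] _ _ [-> ->].
  by move=> q [u _ ->] [[k v] [/= k0 _ _ _] [e0]]; lia.
apply: counted_ext (@straddlingS n.+1); apply: counted_or.
- apply: counted_image cH _ => -[a t] [a' t'] _ _ /= [-> _ /(inj_map (@bump_inj _))].
  by move->.
- apply: counted_or.
  + apply: counted_image cH _ => -[a t] [a' t'] _ _ /= [-> /(inj_map succn_inj)].
    by move->.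
  + apply: counted_image cS _ => -[k u] [k' u'] _ _ /= [-> ].
    by move/cat_injl => /(_ (erefl _))/(inj_map (@addnI _)) ->.
  (* The former 0 is now 1 and is followed by b+1 > a+1 = k, whereas in the spread word only values
     below k follow 1. *)
  move=> p [[a t] [_ [b [/= a0 ab sb]]] ->] [[k u] _ [/= ek et]].
  have := map_subseq S sb; rewrite et => /subseq2_cat_mem.
  have -> : 1 \notin map (addn k.+1) u by apply/mapP=> -[z _]; lia.
  by move=> /(_ isT); rewrite mem_iota; lia.
by move=> p [q _ ->] [[q' _ [_ ]]|[q' _ [_ ]]].
Qed.

Theorem theorem7p3 (n : nat) : 1 <= n ->
  #|[set s : {perm 'I_n} | almost_increasing1 s]| =
  #|[set s : {perm 'I_n} | evil_avoiding s]|.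
Proof.
move=> _; have [cA _] := almost_counted n; have [_ [_ [cE _ _ _]]] := evil_counted n.
rewrite (card_counted cA); [|by move=> w []|exact: almostE].
rewrite (card_counted cE); [by []|by move=> w []|] => s.
rewrite evilE; split=> [E|[]//]; split=> //; exact: word_isperm.
Qed.
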